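(* Let $p\in(0,1)$ and suppose the probability distribution $F$ on $\mathbb{R}$ has finite $k$-th moment, $k\ge 1$. Then, as $n\to\infty$, $$\sup_{S\in\mathfrak S_n}\mathrm{VaR}_p(S)=n\mu_{p,1}-o(n^{1/k}),$$ and $$\inf_{S\in\mathfrak S_n}\mathrm{VaR}_p(S)=n\mu_{0,p}+o(n^{1/k}).$$
   Context: All random variables are defined on a common atomless probability space $(\Omega,\mathcal A,\mathbb P)$, on which independent random vectors with any distributions can be generated. For a distribution $F$, $\mathfrak S_n=\{X_1+\cdots+X_n: X_i\sim F,\ i=1,\ldots,n\}$ (sums with arbitrary dependence). $F^{-1}(t)=\inf\{x:F(x)\ge t\}$ for $t\in(0,1]$. The Value-at-Risk is $\mathrm{VaR}_p(X)=\inf\{x:\mathbb P(X\le x)\ge p\}$, $p\in(0,1)$. For $1\ge q>p\ge 0$, $\mu_{p,q}=\frac{1}{q-p}\int_p^q F^{-1}(t)\,dt$. Here $k$ is a real number, and finite $k$-th moment means $\mathbb{E}[|X|^k]<\infty$ for $X\sim F$. *)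

(* Defs.v *)
From HB Require Import structures.
From mathcomp Require Import all_boot all_order all_algebra.
From mathcomp Require Import all_classical all_reals all_analysis.

Set Implicit Arguments.
Unset Strict Implicit.
Unset Printing Implicit Defensive.

Import Order.TTheory GRing.Theory Num.Theory.
Import numFieldNormedType.Exports.

Local Open Scope classical_set_scope.
Local Open Scope ring_scope.
Local Open Scope ereal_scope.

Definition atomless (R : realType) (d : measure_display)
    (T : measurableType d) (P : probability T R) : Prop :=
  forall A : set T, measurable A -> 0 < P A ->
    exists B : set T, [/\ measurable B, B `<=` A, 0 < P B & P B < P A].

Definition has_law (R : realType) (d d' : measure_display)
    (T : measurableType d) (T' : measurableType d') (P : probability T R)
    (X : {RV P >-> T'}) (Q : probability T' R) : Prop :=
  forall A : set T', measurable A -> distribution P X A = Q A.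

(* The vectors may have different dimensions [dim i]. *)
Definition mutually_independent (R : realType) (d : measure_display)
    (T : measurableType d) (P : probability T R) (m : nat) (dim : 'I_m -> nat)
    (X : forall i : 'I_m, {RV P >-> (dim i).-tuple (measurableTypeR R)}) :
    Prop :=
  forall (J : {set 'I_m})
         (B : forall i : 'I_m, set ((dim i).-tuple (measurableTypeR R))),
    (forall i, measurable (B i)) ->
    P (\bigcap_(i in [set` J]) (X i @^-1` B i)) =
    \prod_(i in J) P (X i @^-1` B i).

(* Independent random vectors with any distributions exist on [(T, P)]. This
   follows from atomlessness, and is the reason for assuming it. *)
Definition generates_independent_vectors (R : realType) (d : measure_display)
    (T : measurableType d) (P : probability T R) : Prop :=
  forall (m : nat) (dim : 'I_m -> nat)
         (Q : forall i : 'I_m,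
            probability ((dim i).-tuple (measurableTypeR R)) R),
    exists X : forall i : 'I_m, {RV P >-> (dim i).-tuple (measurableTypeR R)},
      (forall i, has_law (X i) (Q i)) /\ mutually_independent X.

(* A distribution is a Borel probability measure [F], with distribution
   function [x |-> F `]-oo, x]]. The value is [+oo] when no such [x] exists,
   which may happen only at [t = 1] if [t] is in ]0, 1]. *)
Definition quantile (R : realType) (F : probability (measurableTypeR R) R)
    (t : R) : \bar R :=
  ereal_inf [set x%:E | x in [set x : R | t%:E <= F `]-oo, x]%classic]].

Definition VaR (R : realType) (d : measure_display) (T : measurableType d)
    (P : probability T R) (p : R) (X : T -> R) : \bar R :=
  ereal_inf [set x%:E | x in
    [set x : R | p%:E <= P [set w | (X w <= x)%R]]].

Definition quantile_mean (R : realType)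
    (F : probability (measurableTypeR R) R) (p q : R) : \bar R :=
  ((q - p)^-1)%:E * \int[@lebesgue_measure R]_(t in `]p, q]%classic) quantile F t.

Definition finite_moment (R : realType)
    (F : probability (measurableTypeR R) R) (k : R) : Prop :=
  \int[F]_x ((`|x| `^ k)%R)%:E < +oo.

Definition dependent_sums (R : realType) (d : measure_display)
    (T : measurableType d) (P : probability T R)
    (F : probability (measurableTypeR R) R) (n : nat) : set (T -> R) :=
  [set S | exists X : 'I_n -> {RV P >-> measurableTypeR R},
     (forall i, has_law (X i) F) /\
     S = (fun w => \sum_(i < n) (X i w : R))%R].

(* Main.v *)
(* Lower bound on the supremum: take one uniform variable U and rotate an
   interval ]a, b] of its range by i (b - a) / n to get U_i, which is again
   uniform, so that X_i = F^-1(U_i) has law F. For U in ]a, b] the points U_i are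
   equally spaced in ]a, b], hence the sum of the X_i is a Riemann sum of the
   monotone function F^-1 and differs from n mu_{a,b} by at most
   F^-1(b) - F^-1(a). With a = p - c/n and b = 1 - c/n the error is a constant
   plus a multiple of n times the integral of |F^-1| over a set of measure
   O(1/n), which is o(n^{1/k}) because |F^-1|^k is integrable.
   Upper bound: with z = F^-1(p), E (S - n z)^+ <= n E (X - z)^+ for any sum S,
   and E (X - z)^+ = (1 - p) (mu_{p,1} - z), so Markov's inequality gives
   VaR_p(S) <= n mu_{p,1}.
   The infimum is treated in the same way, with a = c/n and b = p + c/n. *)
Require Import Defs.
From HB Require Import structures.
From mathcomp Require Import all_boot all_order all_algebra.
From mathcomp Require Import all_classical all_reals all_analysis.
From mathcomp Require Import measurable_realfun ring lra.

Set Implicit Arguments.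
Unset Strict Implicit.
Unset Printing Implicit Defensive.

Import Order.TTheory GRing.Theory Num.Theory.
Import numFieldNormedType.Exports.

Local Open Scope classical_set_scope.
Local Open Scope ring_scope.

(* [quantile F] may be infinite outside of ]0, 1[. *)
Definition quantile_fun (R : realType) (F : probability (measurableTypeR R) R)
  : measurableTypeR R -> measurableTypeR R :=
  (fun u : R => fine (quantile F u)) \_ (`]0, 1[ : set R).

(** * The quantile function as generalized inverse of the distribution function *)

Section quantile_galois.
Context {R : realType} (F : probability (measurableTypeR R) R).
Implicit Types u x : R.

(** Seen as a random variable under [F], the identity has the distribution function of [F] as its
    [cdf], so limits and right continuity of [cdf] apply. *)
Let id_R : measurableTypeR R -> R := idfun.

#[local] HB.instance Definition _ :=
  @isMeasurableFun.Build _ _ _ _ id_R (@measurable_id _ _ setT).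

Let FE x : cdf (id_R : {RV F >-> R}) x = F `]-oo, x]%classic.
Proof. by []. Qed.

Let F_mono x y : x <= y -> (F `]-oo, x]%classic <= F `]-oo, y]%classic)%E.
Proof. by move=> xy; rewrite -!FE cdf_nondecreasing. Qed.

Let F_ge u : u < 1 -> exists x, (u%:E <= F `]-oo, x]%classic)%E.
Proof.
move=> u1; apply: contrapT => /forallNP h.
suff : (1 <= u%:E)%E by rewrite lee_fin leNgt u1.
apply: (cvge_le _ (cvg_cdfy1 (id_R : {RV F >-> R}))).
by near=> x; rewrite FE ltW// ltNge; apply/negP/h.
Unshelve. all: by end_near. Qed.

Let F_lt u : 0 < u -> exists x, (F `]-oo, x]%classic < u%:E)%E.
Proof.
move=> u0; apply: contrapT => /forallNP h.
suff : (u%:E <= 0)%E by rewrite lee_fin leNgt u0.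
apply: (cvge_ge _ (cvg_cdfNy0 (id_R : {RV F >-> R}))).
by near=> x; rewrite FE leNgt; apply/negP/h.
Unshelve. all: by end_near. Qed.

Let F_rc u x : (forall y, x < y -> (u%:E <= F `]-oo, y]%classic)%E) ->
  (u%:E <= F `]-oo, x]%classic)%E.
Proof.
move=> h; rewrite -FE.
apply: (cvge_ge _ (@cdf_right_continuous _ _ _ _ (id_R : {RV F >-> R}) x)).
by near=> y; rewrite FE; apply: h; near: y; exact: nbhs_right_gt.
Unshelve. all: by end_near. Qed.

Let level_lbound u : 0 < u -> has_lbound [set x : R | (u%:E <= F `]-oo, x]%classic)%E].
Proof.
move=> /F_lt[y yu]; exists y => x /= ux; rewrite leNgt; apply/negP => xy.
by have := le_lt_trans (le_trans ux (F_mono (ltW xy))) yu; rewrite ltxx.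
Qed.

Lemma quantileE u : 0 < u < 1 -> quantile F u = (quantile_fun F u)%:E.
Proof.
move=> /andP[u0 u1]; rewrite /quantile_fun patchE mem_set; last by rewrite /= in_itv/= u0.
rewrite fineK// /quantile ereal_inf_EFin//; first exact: level_lbound.
exact: F_ge.
Qed.

(** By right continuity, the infimum that defines the quantile belongs to the level set. This Galois
    connection is what later turns events about quantiles into events about levels. *)
Lemma quantile_fun_le u x : 0 < u < 1 ->
  (quantile_fun F u <= x) = (u%:E <= F `]-oo, x]%classic)%E.
Proof.
move=> u01; have /andP[u0 u1] := u01.
have E : quantile_fun F u = inf [set x : R | (u%:E <= F `]-oo, x]%classic)%E].
  apply: EFin_inj; rewrite -quantileE// /quantile ereal_inf_EFin//.
    exact: level_lbound.
  exact: F_ge.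
have ne := F_ge u1; have lb := level_lbound u0.
apply/idP/idP => [qx|ux]; last by rewrite E; exact: ge_inf.
apply: F_rc => y xy.
have [|z /= uz zy] := @inf_lt _ [set x : R | (u%:E <= F `]-oo, x]%classic)%E] y ne.
  by rewrite -E (le_lt_trans qx).
exact: (le_trans uz (F_mono (ltW zy))).
Qed.

Lemma quantile_fun_homo u v : 0 < u -> u <= v -> v < 1 ->
  quantile_fun F u <= quantile_fun F v.
Proof.
move=> u0 uv v1.
have v01 : 0 < v < 1 by rewrite (lt_le_trans u0).
rewrite quantile_fun_le ?u0 ?(le_lt_trans uv)//.
by rewrite (@le_trans _ _ v%:E) ?lee_fin// -quantile_fun_le.
Qed.

(** By monotonicity, the part of ]0, 1[ sent into a ray [[x, +oo[] is an interval, and such rays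
    generate the Borel sets. *)
Lemma measurable_quantile_fun : measurable_fun setT (quantile_fun F).
Proof.
apply/(measurable_restrictT _ _).1 => //.
apply: (@eq_measurable_fun _ _ _ _ _ (quantile_fun F)).
  by move=> u u01; rewrite /quantile_fun patchE u01.
move=> mD; apply: (measurability _ (RGenCInfty.measurableE R)) => //.
move=> _ [_ [x ->] <-].
apply: is_interval_measurable => s t/=.
rewrite !in_itv/= !andbT => -[/andP[s0 s1] qs] [/andP[t0 t1] qt].
move=> u /andP[su ut].
have u1 := le_lt_trans ut t1.
rewrite in_itv/= (lt_le_trans s0 su) u1 in_itv/= andbT; split => //.
by rewrite (le_trans qs)// quantile_fun_homo.
Qed.

End quantile_galois.

(** * The quantile transform of a uniform variable *)

Definition mfun_of d d' (T : measurableType d) (T' : measurableType d')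
    (f : T -> T') (mf : measurable_fun setT f) : {mfun T >-> T'} :=
  HB.pack f (isMeasurableFun.Build _ _ _ _ f mf).

Lemma measure_eq_mod_null d (T : measurableType d) (R : realType)
    (P : {measure set T -> \bar R}) (N A B : set T) :
  measurable N -> P N = 0%E -> measurable A -> measurable B ->
  (forall w, ~ N w -> A w <-> B w) -> P A = P B.
Proof.
move=> mN PN mA mB AB.
have split_ C : measurable C -> P C = P (C `\` N).
  move=> mC; rewrite [LHS](measureDI _ mC mN).
  by rewrite [X in (_ + X)%E](subset_measure0 _ _ _ PN) ?adde0//; exact: measurableI.
rewrite (split_ A)// (split_ B)//; congr (P _).
by apply/seteqP; split=> w [Cw Nw]; split=> //; apply/AB.
Qed.

Section quantile_transform.
Context d (T : measurableType d) (R : realType) (P : probability T R)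
  (F : probability (measurableTypeR R) R).

(** Only levels in ]0, 1[ are prescribed, and the endpoints count as outside because quantiles may
    be infinite there. *)
Definition uniformly_distributed (V : T -> measurableTypeR R) : Prop :=
  [/\ measurable_fun setT V, P (V @^-1` ~` `]0, 1[%classic) = 0%E &
   forall y : R, 0 < y < 1 -> P (V @^-1` `]-oo, y]%classic) = y%:E].

(** Off a null event, the quantile of [V w] is at most [x] exactly when [V w] is at most [F ]-oo,
    x]]. Hence the two laws agree on rays, and rays determine a probability measure. *)
Lemma quantile_transform (V : T -> measurableTypeR R) :
  uniformly_distributed V ->
  forall A, measurable A -> P ((quantile_fun F \o V) @^-1` A) = F A.
Proof.
move=> [mV V0 VP].
have mqV : measurable_fun setT (quantile_fun F \o V).
  by apply: measurableT_comp mV; exact: measurable_quantile_fun.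
have mpre (W : T -> measurableTypeR R) A : measurable_fun setT W -> measurable A ->
    measurable (W @^-1` A).
  by move=> mW mA; rewrite -[_ @^-1` _]setTI; exact: mW.
have mN : measurable (V @^-1` ~` `]0, 1[%classic).
  by apply: mpre => //; apply: measurableC.
have cdfE x : P ((quantile_fun F \o V) @^-1` `]-oo, x]%classic) = F `]-oo, x]%classic.
  have [f0 f1] : (0 <= F `]-oo, x]%classic)%E /\ (F `]-oo, x]%classic <= 1)%E.
    by split => //; exact: probability_le1.
  have [r Fr] : exists r : R, F `]-oo, x]%classic = r%:E.
    by exists (fine (F `]-oo, x]%classic)); rewrite fineK// fin_num_measure.
  rewrite Fr !lee_fin in f0 f1 *.
  have qV w : ~ (V @^-1` ~` `]0, 1[%classic) w ->
      (quantile_fun F \o V) w <= x <-> V w <= r.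
    move=> /= /contrapT; rewrite in_itv/= => Vw.
    by rewrite quantile_fun_le// Fr lee_fin.
  (* [VP] covers only levels in ]0, 1[. At level 0 the event is null, and at level 1 its complement
     is null. *)
  have [r0|r0] := eqVneq r 0.
    transitivity (P set0); last by rewrite measure0 r0.
    apply: (measure_eq_mod_null mN V0) => //; first exact: mpre.
    move=> w Nw; split => //=; rewrite in_itv/= => /(qV _ Nw).
    by move: Nw => /= /contrapT; rewrite in_itv/= r0 leNgt => /andP[->].
  have [r1|r1] := eqVneq r 1.
    transitivity (P setT); last by rewrite probability_setT r1.
    apply: (measure_eq_mod_null mN V0) => //; first exact: mpre.
    move=> w Nw; split => //= _; rewrite in_itv/=; apply/(qV _ Nw).
    by move: Nw => /= /contrapT; rewrite in_itv/= r1 => /andP[_ /ltW].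
  rewrite -VP ?lt_neqAle ?f0 ?f1 ?r1 1?eq_sym ?r0//.
  apply: (measure_eq_mod_null mN V0); [exact: mpre|exact: mpre|].
  by move=> w Nw; rewrite /= !in_itv/=; exact: qV.
move=> A mA.
pose Q : probability (measurableTypeR R) R := distribution P (mfun_of mqV).
suff : Q A = F A by [].
(* The rays []x, +oo[] are stable under intersection, generate the Borel sets, and exhaust the line
   along [x = - n]. *)
apply: (measure_unique [set B : set (measurableTypeR R) | exists x, B = `]x, +oo[%classic]
  (fun n => `](- n%:R)%R, +oo[%classic)) => //.
- exact: RGenOInfty.measurableE.
- move=> _ _ [x ->] [y ->]; exists (Num.max x y).
  by apply/seteqP; split=> z /=; rewrite !in_itv/= !andbT gt_max => /andP.
- by move=> n; exists (- n%:R).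
- apply/seteqP; split=> // x _; exists (Num.bound `|x|) => //=.
  rewrite in_itv/= andbT ltrNl (le_lt_trans (ler_norm _))// normrN.
  exact: archi_boundP.
- move=> _ [x ->]; rewrite -(setCitvl (BRight x)).
  rewrite [LHS](@probability_setC _ _ _ Q)// [RHS](@probability_setC _ _ _ F)//.
  by congr (1 - _)%E; exact: cdfE.
- by move=> n; rewrite (le_lt_trans (probability_le1 _ _)) ?ltry.
Qed.

End quantile_transform.

(** * Uniform variables and integration against [F] *)

Section uniform_variable.
Context {R : realType}.

Let unif : probability (measurableTypeR R) R := uniform_prob (@ltr01 R).

Lemma uniform_prob01E (A : set (measurableTypeR R)) : measurable A ->
  unif A = lebesgue_measure (A `&` `[0, 1]%classic).
Proof.
move=> mA; rewrite /unif /= /uniform_prob integral_uniform_pdf.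
rewrite -[RHS]mul1e -integral_cst//; last exact: measurableI.
apply: eq_integral => x; rewrite inE/= in_itv/= => -[_ x01].
by rewrite /uniform_pdf x01 subr0 invr1.
Qed.

Lemma uniformly_distributed_id : uniformly_distributed unif idfun.
Proof.
split; first exact: measurable_id.
- rewrite preimage_id uniform_prob01E; last exact: measurableC.
  apply: countable_lebesgue_measure0.
  apply: (@sub_countable _ _ _ [set 0; 1]); last exact: finite_set_countable.
  apply: subset_card_le => x [/=]; rewrite !in_itv/= => x01 /andP[x0 x1].
  have [->|x0'] := eqVneq x 0; [by left|right].
  apply/eqP; rewrite eq_le x1 leNgt; apply/negP => x1'; apply: x01.
  by rewrite lt_neqAle eq_sym x0' x0.
- move=> y /andP[y0 y1]; rewrite preimage_id uniform_prob01E//.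
  rewrite (_ : _ `&` _ = `[0, y]%classic).
    by rewrite lebesgue_measure_itv/= lte_fin y0 sube0.
  apply/seteqP; split=> x /=; rewrite !in_itv/=.
    by move=> [-> /andP[->]].
  by move=> /andP[-> xy]; rewrite xy (le_trans xy)// ltW.
Qed.

(** The generation hypothesis is applied to a single vector of dimension one with uniform law. *)
Lemma exists_uniform d (T : measurableType d) (P : probability T R) :
  generates_independent_vectors P ->
  exists U : T -> measurableTypeR R,
    uniformly_distributed P U /\ forall w, 0 < U w < 1.
Proof.
pose f (x : measurableTypeR R) : 1.-tuple (measurableTypeR R) := [tuple x].
have mf : measurable_fun setT f.
  apply/measurable_fun_tnthP => i; rewrite ord1.
  exact: measurable_id.
move=> /(_ 1%N (fun=> 1%N) (fun=> distribution unif (mfun_of mf)))[Y [+ _]].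
move=> /(_ ord0) Ylaw.
pose V w : measurableTypeR R := tnth (Y ord0 w) ord0.
have mV : measurable_fun setT V.
  by apply: (measurableT_comp (measurable_tnth ord0)); exact: measurable_funP.
have VE A : measurable A -> P (V @^-1` A) = unif A.
  move=> mA; have mB : measurable ((@tnth 1 (measurableTypeR R) ^~ ord0) @^-1` A).
    by rewrite -[_ @^-1` _]setTI; exact: measurable_tnth.
  exact: (Ylaw _ mB).
have [_ N0 CDF] := uniformly_distributed_id.
pose D : set (measurableTypeR R) := `]0, 1[%classic.
have mD : measurable D by exact: measurable_itv.
(* Values outside ]0, 1[ occur with probability 0; replacing them by 1/2 makes the bounds on [U]
   hold at every outcome. *)
pose g (x : measurableTypeR R) : measurableTypeR R := if x \in D then x else 2^-1.
have mg : measurable_fun setT g.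
  apply: measurable_fun_ifT; [|exact: measurable_id|exact: measurable_cst].
  apply: (measurable_fun_bool true).
  rewrite setTI [X in measurable X](_ : _ = D)//.
  by apply/seteqP; split=> x /=; [move/set_mem|move/mem_set].
have g01 x : 0 < g x < 1.
  rewrite /g; case: ifPn => [/set_mem|_]; last lra.
  by rewrite /D/= in_itv.
have mN : measurable (V @^-1` ~` D).
  by rewrite -[_ @^-1` _]setTI; apply: mV => //; exact: measurableC.
exists (g \o V); split; last by move=> w; exact: g01.
split; first exact: measurableT_comp mg mV.
- rewrite (_ : _ @^-1` _ = set0) ?measure0//; apply/seteqP; split=> w //=.
  by rewrite in_itv/= g01.
- move=> y y01; rewrite -[RHS](CDF y y01).
  rewrite preimage_id -VE//.
  apply: (@measure_eq_mod_null _ _ _ _ (V @^-1` ~` D)) => //.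
  + exact: (etrans (VE _ (measurableC mD)) N0).
  + by rewrite -[_ @^-1` _]setTI; apply: (measurableT_comp mg mV).
  + by rewrite -[_ @^-1` _]setTI; apply: mV.
  + by move=> w /= /contrapT Dw; rewrite /g mem_set.
Qed.

(** The quantile transform of the identity shows that [F] is the image of Lebesgue measure on ]0, 1[
    under [quantile_fun F]. *)
Lemma ge0_integral_quantile (F : probability (measurableTypeR R) R)
    (phi : measurableTypeR R -> \bar R) :
  measurable_fun setT phi -> (forall x, 0 <= phi x)%E ->
  (\int[F]_x phi x =
   \int[lebesgue_measure]_(u in `]0%R, 1%R[) phi (quantile_fun F u))%E.
Proof.
move=> mphi phi0.
have mphiq := measurableT_comp mphi (measurable_quantile_fun F).
transitivity (\int[distribution unif (mfun_of (measurable_quantile_fun F))]_x phi x)%E.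
  apply: eq_measure_integral => A mA _.
  exact/esym/(quantile_transform F uniformly_distributed_id).
rewrite ge0_integral_distribution// integral_uniform//.
rewrite subr0 invr1 mul1e integral_itv_bndoo//.
- exact: measurable_funTS mphiq.
- by move=> x; exact: phi0.
Qed.

End uniform_variable.

Lemma ge0_integral_law d d' (T : measurableType d) (T' : measurableType d')
    (R : realType) (P : probability T R) (X : {RV P >-> T'})
    (Q : probability T' R) (phi : T' -> \bar R) :
  has_law X Q -> measurable_fun setT phi -> (forall x, 0 <= phi x)%E ->
  (\int[P]_w phi (X w) = \int[Q]_x phi x)%E.
Proof.
move=> XQ mphi phi0; rewrite -[LHS](ge0_integral_distribution X)//.
by apply: eq_measure_integral => A mA _; exact: XQ.
Qed.

(** * Rotations of an interval preserve the uniform law *)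

Section rotation.
Context {R : realType}.
Implicit Types a b c u v h y : R.

(* The rotation by [c] of the circle obtained from ]a, b] by gluing its ends,
   extended by the identity. *)
Definition rotation a b c u : R :=
  if a < u <= b then (if u + c <= b then u + c else u + c - (b - a)) else u.

Lemma rotation_itv a b c u : 0 <= c <= b - a -> a < u <= b ->
  a < rotation a b c u <= b.
Proof. by rewrite /rotation => c0 uab; rewrite uab; case: ifPn; lra. Qed.

Lemma rotation_id a b c u : ~~ (a < u <= b) -> rotation a b c u = u.
Proof. by rewrite /rotation => /negbTE ->. Qed.

Lemma measurable_rotation a b c :
  measurable_fun setT (rotation a b c : measurableTypeR R -> measurableTypeR R).
Proof.
have mDc : measurable_fun setT (fun u : measurableTypeR R => u + c : measurableTypeR R).
  exact: measurable_funD.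
apply: measurable_fun_ifT; last exact: measurable_id.
  by apply: measurable_and; [exact: measurable_fun_ltr|exact: measurable_fun_ler].
apply: measurable_fun_ifT; [exact: measurable_fun_ler|exact: mDc|].
exact: measurable_funD.
Qed.

Section uniform.
Context d (T : measurableType d) (P : probability T R) (U : T -> measurableTypeR R).
Hypothesis uU : uniformly_distributed P U.

Lemma uniformly_distributed_itv_oc x y : 0 < x -> x <= y -> y < 1 ->
  P (U @^-1` `]x, y]%classic) = (y - x)%:E.
Proof.
move=> x0 xy y1; have [mU _ UP] := uU.
have mI z : measurable (U @^-1` `]-oo, z]%classic).
  by rewrite -[_ @^-1` _]setTI; exact: mU.
rewrite (_ : U @^-1` `]x, y]%classic =
    U @^-1` `]-oo, y]%classic `\` U @^-1` `]-oo, x]%classic); last first.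
  apply/seteqP; split=> w /=; rewrite !in_itv/=.
    by move=> /andP[xU ->]; split => //; apply/negP; rewrite -ltNge.
  by move=> [-> /negP]; rewrite -ltNge => ->.
rewrite measureD//; last by rewrite (le_lt_trans (probability_le1 _ _)) ?ltry.
rewrite setIidr; last by move=> w /=; rewrite !in_itv/= => /le_trans; exact.
by rewrite EFinB; congr (_ - _)%E; apply: UP; lra.
Qed.

(** The points that a rotation sends below a level [y] form a ray and an interval, of total mass
    [y]. *)
Lemma uniformly_distributed_rotation a b c : 0 < a -> b < 1 -> 0 <= c <= b - a ->
  uniformly_distributed P (rotation a b c \o U).
Proof.
move=> a0 b1 c0; have [mU U0 UP] := uU.
split.
- exact: measurableT_comp (measurable_rotation a b c) mU.
- rewrite -[RHS]U0; congr (P _); apply/seteqP; split=> w /=.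
  + apply: contra_not; rewrite !in_itv/=.
    have [Uab|Uab] := boolP (a < U w <= b); last by rewrite rotation_id.
    by have := rotation_itv c0 Uab; lra.
  + apply: contra_not; rewrite !in_itv/=.
    by have [Uab|Uab] := boolP (a < U w <= b); [lra|rewrite rotation_id].
- move=> y /andP[y0 y1].
  (* The set is []-oo, s0]] together with []s1, s2]]. The interval is empty if [y] is not between
     [a] and [b]. If [a + c <= y], it consists of all points that wrap around; otherwise only some
     of these land below [y], and the ray stops at [a]. *)
  have [s0 [s1 [s2 [[s00 s01 s12 s21] [s0E sE]]]]] : exists s0 s1 s2, [/\ 0 < s0,
    s0 <= s1, s1 <= s2 & s2 < 1] /\ s0 + (s2 - s1) = y /\
    forall u, rotation a b c u <= y <-> u <= s0 \/ s1 < u <= s2.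
    have [yab|yab] := boolP (a < y < b); last first.
      exists y, y, y; split; first by split; lra.
      split=> [|u]; first lra.
      by rewrite /rotation; case: ifPn => uab; try case: ifPn; lra.
    have [yc|yc] := leP (a + c) y.
      exists (y - c), (b - c), b; split; first by split; lra.
      split=> [|u]; first lra.
      by rewrite /rotation; case: ifPn => uab; try case: ifPn; lra.
    exists a, (b - c), (b - c + (y - a)); split; first by split; lra.
    split=> [|u]; first lra.
    by rewrite /rotation; case: ifPn => uab; try case: ifPn; lra.
  have mI A : measurable A -> measurable (U @^-1` A).
    by move=> mA; rewrite -[_ @^-1` _]setTI; exact: mU.
  rewrite (_ : _ @^-1` _ =
      U @^-1` `]-oo, s0]%classic `|` U @^-1` `]s1, s2]%classic); last first.
    by apply/seteqP; split=> w /=; rewrite !in_itv/=; move/sE.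
  rewrite measureU//; [|exact: mI|exact: mI|].
    rewrite -s0E EFinD; congr (_ + _)%E; first by apply: UP; lra.
    by apply: uniformly_distributed_itv_oc; lra.
  apply/seteqP; split=> w //= []; rewrite !in_itv/=; lra.
Qed.

End uniform.
End rotation.

(** * Riemann sums of a monotone function over the orbit of a rotation *)

Section rotation_sum.
Context {R : realType}.
(** [Phi] plays the role of a primitive of [g]: its increments lie between the rectangles at the
    left and at the right endpoint. *)
Variables (g Phi : R -> R) (a b : R).
Hypothesis ab : a < b.
Hypothesis g_homo : forall x y, a <= x -> x <= y -> y <= b -> g x <= g y.
Hypothesis Phi_ge : forall x y, a <= x -> x <= y -> y <= b ->
  (y - x) * g x <= Phi y - Phi x.
Hypothesis Phi_le : forall x y, a <= x -> x <= y -> y <= b ->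
  Phi y - Phi x <= (y - x) * g y.

Let grid_block n h u : 0 < h -> a < u <= a + n%:R * h ->
  exists2 j, (j < n)%N & a < u - j%:R * h <= a + h.
Proof.
move=> h0; elim: n => [|n IH] in u *; first by lra.
have [un|un] := leP u (a + n%:R * h).
  move=> /andP[au _]; have [|j jn ju] := IH u; first by rewrite au.
  by exists j => //; rewrite (ltn_trans jn).
by rewrite -natr1 => u1; exists n => //; lra.
Qed.

Let sum_le h v m : 0 <= h -> a <= v -> v + m%:R * h <= b ->
  Phi (v + m%:R * h) - Phi v <= h * \sum_(0 <= l < m) g (v + l.+1%:R * h).
Proof.
move=> h0 av; elim: m => [|m IH]; first by rewrite big_nil mulr0 mul0r addr0 subrr.
rewrite -natr1 => vm; rewrite big_nat_recr//= mulrDr.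
have mh : 0 <= m%:R * h by rewrite mulr_ge0.
have := IH _; have := @Phi_le (v + m%:R * h) (v + (m%:R + 1) * h).
rewrite natr1 (_ : _ - (v + m%:R * h) = h); last by rewrite -natr1; ring.
rewrite -natr1.
by move=> /(_ _ _ _)/wrap[]; try lra; move=> ? /(_ _)/wrap[]; lra.
Qed.

Let sum_ge h v m : 0 <= h -> a <= v -> v + m%:R * h <= b ->
  h * \sum_(0 <= l < m) g (v + l%:R * h) <= Phi (v + m%:R * h) - Phi v.
Proof.
move=> h0 av; elim: m => [|m IH]; first by rewrite big_nil mulr0 mul0r addr0 subrr.
rewrite -natr1 => vm; rewrite big_nat_recr//= mulrDr.
have mh : 0 <= m%:R * h by rewrite mulr_ge0.
have := IH _; have := @Phi_ge (v + m%:R * h) (v + (m%:R + 1) * h).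
rewrite (_ : _ - (v + m%:R * h) = h); last by ring.
by move=> /(_ _ _ _)/wrap[]; try lra; move=> ? /(_ _)/wrap[]; lra.
Qed.

(** The grid covers [[v, v + (n - 1) h]]; the two pieces left over at [a] and [b] have total length
    [h]. On the covered part the increment of [Phi] lies between a left and a right sum, and
    monotonicity controls the pieces. *)
Lemma grid_sum_bound n h v : (0 < n)%N -> n%:R * h = b - a ->
  a < v <= a + h ->
  `|h * \sum_(0 <= l < n) g (v + l%:R * h) - (Phi b - Phi a)| <= h * (g b - g a).
Proof.
case: n => // m _ mh /andP[av vh].
rewrite -natr1 in mh.
have h0 : 0 < h by lra.
have m0 : 0 <= m%:R * h by rewrite mulr_ge0// ltW.
have vm : v <= v + m%:R * h by lra.
have vb : v + m%:R * h <= b by lra.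
have le_ := sum_le (ltW h0) (ltW av) vb.
have ge_ := sum_ge (ltW h0) (ltW av) vb.
set S := \sum_(0 <= l < m.+1) _.
(* Without its last term the sum is a left sum, without its first term a right sum. *)
have S1 : S = \sum_(0 <= l < m) g (v + l%:R * h) + g (v + m%:R * h).
  by rewrite /S big_nat_recr.
have S2 : S = g v + \sum_(0 <= l < m) g (v + l.+1%:R * h).
  by rewrite /S big_nat_recl// mul0r addr0.
have Pv1 := Phi_ge (lexx a) (ltW av) (le_trans vm vb).
have Pv2 := Phi_le (lexx a) (ltW av) (le_trans vm vb).
have Pm1 := Phi_ge (le_trans (ltW av) vm) vb (lexx b).
have Pm2 := Phi_le (le_trans (ltW av) vm) vb (lexx b).
have Eb : b - (v + m%:R * h) = h - (v - a) by lra.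
have gav : g a <= g v by apply: g_homo => //; lra.
have gvm : g v <= g (v + m%:R * h) by apply: g_homo => //; lra.
have gmb : g (v + m%:R * h) <= g b by apply: g_homo => //; lra.
(* These products are what remains of the deficit and of the excess after cancellation. *)
have low : (h - (v - a)) * (g b - g v) <= h * (g b - g a) by apply: ler_pM; lra.
have upp : (v - a) * (g (v + m%:R * h) - g a) <= h * (g b - g a) by apply: ler_pM; lra.
rewrite Eb in Pm1 Pm2; rewrite ler_norml; apply/andP; split.
  rewrite S2 mulrDr; lra.
rewrite S1 mulrDr; lra.
Qed.

(** If [u] lies in block [j] of length [h], counted from 0, then [v] is its translate in block 0,
    and the rotations visit the grid through [v] in cyclic order starting at block [j]. *)
Lemma rotation_sum n h u : (0 < n)%N -> n%:R * h = b - a -> a < u <= b ->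
  exists2 v, a < v <= a + h &
  \sum_(i < n) g (rotation a b (i%:R * h) u) = \sum_(0 <= l < n) g (v + l%:R * h).
Proof.
move=> n0 nh /andP[au ub].
have h0 : 0 < h by rewrite -(pmulr_rgt0 _ (_ : 0 < n%:R)) ?ltr0n//; lra.
have [j jn jv] : exists2 j, (j < n)%N & a < u - j%:R * h <= a + h.
  by apply: (@grid_block n) => //; lra.
exists (u - j%:R * h) => //; set v := u - j%:R * h.
rewrite -(big_mkord xpredT (fun i => g (rotation a b (i%:R * h) u))).
(* The first [n - j] rotations do not wrap and reach blocks [j] to [n - 1]; the other [j] wrap and
   reach blocks 0 to [j - 1]. *)
rewrite (@big_cat_nat _ _ _ (n - j)%N)//= ?leq_subr//.
rewrite [RHS](@big_cat_nat _ _ _ j)//= ?(ltnW jn)//.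
rewrite addrC; congr (_ + _).
  rewrite -{1}(add0n (n - j)%N) big_addn subKn ?(ltnW jn)//.
  rewrite !big_nat; apply: eq_bigr => l /andP[_ lj]; congr g.
  rewrite /rotation au ub/= natrD natrB ?(ltnW jn)// ifF; first by rewrite /v; lra.
  by apply/negbTE; rewrite -ltNge; have := ler0n R l; nra.
rewrite -{2}(add0n j) big_addn.
rewrite !big_nat; apply: eq_bigr => l /andP[_ lj]; congr g.
rewrite /rotation au ub/= natrD ifT; first by rewrite /v; lra.
have : l.+1%:R + j%:R <= n%:R :> R
  by rewrite -natrD ler_nat addSn addnC -ltn_subRL.
by rewrite -natr1; nra.
Qed.

End rotation_sum.

(** * The primitive of the quantile function, and its tails *)

Lemma lebesgue_measure_oc (R : realType) (x y : R) : x <= y ->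
  @lebesgue_measure R `]x, y]%classic = (y - x)%:E.
Proof.
rewrite (lebesgue_measure_itv `]x, y])/= lte_fin le_eqVlt.
by move=> /predU1P[->|->]; rewrite ?ltxx ?subrr ?EFinB.
Qed.

(** Above [a], write [x] as [x^k x^(1 - k)] and use that the exponent [1 - k] is not positive. The
    level [a] serves as a truncation that trades the first power for the k-th. *)
Lemma le_add_powR (R : realType) (k a x : R) : 1 <= k -> 0 < a -> 0 <= x ->
  x <= a + x `^ k * a `^ (1 - k).
Proof.
move=> k1 a0 x0; have [xa|ax] := leP x a.
  by rewrite (le_trans xa)// lerDl mulr_ge0// powR_ge0.
rewrite -[leLHS]add0r lerD ?(ltW a0)//.
have xp : 0 < x by exact: lt_trans ax.
have ak : 0 < a `^ (k - 1) by exact: powR_gt0.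
rewrite -(opprB k) powRN ler_pdivlMr//.
have k0 : 0 < k by rewrite (lt_le_trans _ k1).
rewrite -(@mulr_powRB1 _ x k)// ler_wpM2l//.
by rewrite ge0_ler_powR ?nnegrE ?subr_ge0 ?(ltW ax) ?(ltW a0).
Qed.

Section quantile_primitive.
Context {R : realType} (F : probability (measurableTypeR R) R) (k : R).
Hypotheses (k1 : 1 <= k) (Fk : finite_moment F k).

Local Notation mu := (@lebesgue_measure R).
Let q := quantile_fun F.

Let mu01 : mu `]0, 1[ = 1%E.
Proof. by rewrite (lebesgue_measure_itv `]0, 1[)/= lte_fin ltr01 sube0. Qed.

Let q_out u : ~ (`]0, 1[%classic : set R) u -> q u = 0.
Proof. by move=> u01; rewrite /q /quantile_fun patchE memNset. Qed.

Let mq : measurable_fun setT q.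
Proof. exact: measurable_quantile_fun. Qed.

Let mabsk : measurable_fun [set: measurableTypeR R] (fun x => (`|x| `^ k)%:E).
Proof.
apply/measurable_EFinP; apply: (measurableT_comp (measurable_powR k)).
exact: normr_measurable.
Qed.

Let mqk : measurable_fun setT (fun u => `|q u| `^ k : measurableTypeR R).
Proof.
apply: (measurableT_comp (measurable_powR k)).
exact: measurableT_comp mq.
Qed.

Let integrable_extend (f : R -> R) : (forall u, ~ (`]0, 1[%classic : set R) u -> f u = 0) ->
  mu.-integrable `]0, 1[ (EFin \o f) -> mu.-integrable setT (EFin \o f).
Proof.
move=> f0; rewrite integrable_mkcond//.
apply: eq_integrable => // u _; rewrite patchE.
by case: ifPn => //= /negP; rewrite inE => /f0->.
Qed.

Lemma integrable_quantile_powR : mu.-integrable setT (EFin \o (fun u => `|q u| `^ k)).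
Proof.
apply: integrable_extend.
  by move=> u /q_out ->; rewrite normr0 powR0// gt_eqF// (lt_le_trans _ k1).
apply/integrableP; split; first exact/measurable_EFinP/measurable_funTS.
under eq_integral do rewrite /= ger0_norm ?powR_ge0//.
rewrite -(ge0_integral_quantile F (phi := fun x => (`|x| `^ k)%:E))//.
Qed.

Lemma integrable_quantile : mu.-integrable setT (EFin \o q).
Proof.
apply: integrable_extend => //.
apply: (@le_integrable _ _ _ _ _ _ _ (EFin \o (fun u => 1 + `|q u| `^ k))) => //.
- exact/measurable_EFinP/measurable_funTS.
- move=> u _ /=; rewrite lee_fin (le_trans (le_add_powR k1 (@ltr01 _) (normr_ge0 _)))//.
  by rewrite powR1 mulr1 ler_norm.
- rewrite (_ : _ \o _ = fun u => (1%:E + ((`|q u| `^ k)%R)%:E)%E)//.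
  apply: integrableD => //.
    apply/integrableP; split; first exact: measurable_cst.
    by rewrite /= normr1 integral_cst//= mul1e mu01 ltry.
  by apply: integrableS integrable_quantile_powR.
Qed.

Let integrable_q (A : set (measurableTypeR R)) : measurable A -> mu.-integrable A (EFin \o q).
Proof. by move=> mA; apply: integrableS integrable_quantile. Qed.

Let integrable_cst x y (c : R) : mu.-integrable `]x, y] (EFin \o cst c).
Proof.
apply/integrableP; split.
  by apply/measurable_EFinP; exact: measurable_cst.
have [xy|yx] := leP x y; last first.
  by rewrite set_itv_ge ?integral_set0 ?ltry// bnd_simp -leNgt ltW.
by rewrite /= integral_cst//= lebesgue_measure_oc// -EFinM ltry.
Qed.

Definition quantile_primitive (x : R) : R := \int[mu]_(u in `]0, x]) q u.

Local Notation Phi := quantile_primitive.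

Lemma quantile_primitiveB x y : 0 <= x -> x <= y ->
  Phi y - Phi x = \int[mu]_(u in `]x, y]) q u.
Proof.
by move=> x0 xy; rewrite /Phi Rintegral_itvB ?bnd_simp//; exact: integrable_q.
Qed.

Lemma quantile_primitive_norm x y : 0 <= x -> x <= y ->
  `|Phi y - Phi x| <= \int[mu]_(u in `]x, y]) `|q u|.
Proof.
move=> x0 xy; rewrite quantile_primitiveB//.
by apply: le_normr_Rintegral => //; exact: integrable_q.
Qed.

Lemma quantile_primitive0 : Phi 0 = 0.
Proof. by rewrite /Phi set_itvoc0 Rintegral_set0. Qed.

Lemma quantile_primitive_ge x y : 0 < x -> x <= y -> y < 1 ->
  (y - x) * q x <= Phi y - Phi x.
Proof.
move=> x0 xy y1; rewrite quantile_primitiveB ?(ltW x0)//.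
have -> : (y - x) * q x = \int[mu]_(u in `]x, y]) q x.
  by rewrite Rintegral_cst//= lebesgue_measure_oc// mulrC.
apply: le_Rintegral => //; [exact: integrable_cst|exact: integrable_q|].
move=> u; rewrite /= in_itv/= => /andP[xu uy].
by apply: quantile_fun_homo; [|exact: ltW|exact: le_lt_trans y1].
Qed.

Lemma quantile_primitive_le x y : 0 <= x -> x <= y -> y < 1 ->
  Phi y - Phi x <= (y - x) * q y.
Proof.
move=> x0 xy y1; rewrite quantile_primitiveB//.
have -> : (y - x) * q y = \int[mu]_(u in `]x, y]) q y.
  by rewrite Rintegral_cst//= lebesgue_measure_oc// mulrC.
apply: le_Rintegral => //; [exact: integrable_q|exact: integrable_cst|].
move=> u; rewrite /= in_itv/= => /andP[xu uy].
by apply: quantile_fun_homo => //; exact: le_lt_trans xu.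
Qed.

Lemma quantile_meanE x y : 0 <= x -> x < y -> y <= 1 ->
  quantile_mean F x y = ((y - x)^-1 * (Phi y - Phi x))%:E.
Proof.
move=> x0 xy y1; rewrite /quantile_mean EFinM; congr (_ * _)%E.
rewrite quantile_primitiveB ?(ltW xy)// /Rintegral fineK; last first.
  by apply: integrable_fin_num => //; exact: integrable_q.
(* The endpoint [y] is left out because [quantile F] may be infinite at 1; both integrals are moved
   to the open interval. *)
have qE u : `]x, y[%classic u -> quantile F u = (q u)%:E.
  rewrite /= in_itv/= => /andP[xu uy]; rewrite quantileE//.
  by rewrite (le_lt_trans x0 xu) (lt_le_trans uy y1).
have mq' (A : set (measurableTypeR R)) : measurable_fun A (EFin \o q).
  by apply/measurable_EFinP; exact: measurable_funTS.
rewrite [RHS]integral_itv_bndoo; last exact: mq'.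
rewrite integral_itv_bndoo.
  by apply: eq_integral => u; rewrite inE => /qE.
by apply: eq_measurable_fun (mq' _) => u; rewrite inE => /qE.
Qed.

Let integral_fineK (A : set (measurableTypeR R)) (f : R -> R) :
  mu.-integrable A (EFin \o f) -> measurable A ->
  (\int[mu]_(u in A) (f u)%:E)%E = (\int[mu]_(u in A) f u)%:E.
Proof. by move=> iF mA; rewrite /Rintegral fineK//; exact: integrable_fin_num. Qed.

(** After the change of variable to [u], monotonicity makes the positive part vanish for [u <= p]
    and equal [q u - q p] for [u > p]. The value is [(1 - p) (mu_{p,1} - q p)]. *)
Lemma integral_pos_part p : 0 < p < 1 ->
  (\int[F]_x (Num.max (x - q p) 0)%:E = (Phi 1 - Phi p - (1 - p) * q p)%:E)%E.
Proof.
move=> /andP[p0 p1]; set z := q p.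
have mmax : measurable_fun [set: measurableTypeR R] (fun x => (Num.max (x - z) 0)%:E).
  apply/measurable_EFinP; apply: measurable_maxr => //.
  exact: measurable_funB.
rewrite (ge0_integral_quantile F mmax) => [|x]; last by rewrite lee_fin le_max lexx orbT.
transitivity (\int[mu]_(u in `]0%R, 1%R[)
    ((fun u => (q u - z)%:E) \_ (`]p, 1%R[ : set R)) u)%E.
  apply: eq_integral => u; rewrite inE /= in_itv/= => /andP[u0 u1].
  rewrite patchE; case: ifPn => [/set_mem|/negP].
    rewrite /= in_itv/= => /andP[pu _]; rewrite max_l// subr_ge0.
    by apply: quantile_fun_homo => //; exact: ltW.
  move=> up; rewrite max_r// subr_le0; apply: quantile_fun_homo => //.
  by rewrite leNgt; apply/negP => pu; apply: up; rewrite inE/= in_itv/= pu.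
rewrite -integral_mkcondr (_ : _ `&` _ = `]p, 1%R[%classic); last first.
  by apply/setIidr => u; rewrite /= !in_itv/= => /andP[pu ->]; rewrite (lt_trans p0).
have iqz : mu.-integrable `]p, 1] (EFin \o (fun u => q u - z)).
  rewrite (_ : _ \o _ = fun u => ((q u)%:E - z%:E)%E)//.
  by apply: integrableB => //; [exact: integrable_q|exact: integrable_cst].
rewrite integral_itv_bndo_bndc.
  rewrite integral_fineK// RintegralB//; [|exact: integrable_q|exact: integrable_cst].
  rewrite Rintegral_cst//= lebesgue_measure_oc ?(ltW p1)//.
  by rewrite quantile_primitiveB ?ltW// [z * _]mulrC.
by apply/measurable_EFinP; apply: measurable_funB => //; exact: measurable_funTS.
Qed.

(** The mirror computation, supported on [u <= p]; the value is [p (q p - mu_{0,p})]. *)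
Lemma integral_neg_part p : 0 < p < 1 ->
  (\int[F]_x (Num.max (q p - x) 0)%:E = (p * q p - Phi p)%:E)%E.
Proof.
move=> /andP[p0 p1]; set z := q p.
have mmax : measurable_fun [set: measurableTypeR R] (fun x => (Num.max (z - x) 0)%:E).
  apply/measurable_EFinP; apply: measurable_maxr => //.
  exact: measurable_funB.
rewrite (ge0_integral_quantile F mmax) => [|x]; last by rewrite lee_fin le_max lexx orbT.
transitivity (\int[mu]_(u in `]0%R, 1%R[)
    ((fun u => (z - q u)%:E) \_ (`]0%R, p] : set R)) u)%E.
  apply: eq_integral => u; rewrite inE /= in_itv/= => /andP[u0 u1].
  rewrite patchE; case: ifPn => [/set_mem|/negP].
    rewrite /= in_itv/= => /andP[_ pu]; rewrite max_l// subr_ge0.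
    exact: quantile_fun_homo.
  move=> up; rewrite max_r// subr_le0; apply: quantile_fun_homo => //.
  by apply/ltW; rewrite ltNge; apply/negP => pu; apply: up; rewrite inE/= in_itv/= pu u0.
rewrite -integral_mkcondr (_ : _ `&` _ = `]0%R, p]%classic); last first.
  by apply/setIidr => u; rewrite /= !in_itv/= => /andP[-> up]; exact: le_lt_trans p1.
have iqz : mu.-integrable `]0, p] (EFin \o (fun u => z - q u)).
  rewrite (_ : _ \o _ = fun u => (z%:E - (q u)%:E)%E)//.
  by apply: integrableB => //; [exact: integrable_cst|exact: integrable_q].
rewrite integral_fineK// RintegralB//; [|exact: integrable_cst|exact: integrable_q].
by rewrite Rintegral_cst//= lebesgue_measure_oc ?(ltW p0)// subr0 mulrC.
Qed.

(** This is the source of the rate, uniformly in [A]. With [N = n^(1/k)], truncate [|q|] at level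
    [d N]: the part below costs at most [d c N], and the part above at most [n (d N)^(1 - k)] times
    the integral of [|q|^k] over [A]. Here [n N^(1 - k) = N], and the integral is small by absolute
    continuity. *)
Lemma tail_integral_small (c e : R) : 0 < c -> 0 < e ->
  \forall n \near \oo, forall A : set (measurableTypeR R), measurable A ->
    (mu A <= (c / n%:R)%:E)%E ->
    n%:R * \int[mu]_(u in A) `|q u| <= e * n%:R `^ k^-1.
Proof.
move=> c0 e0; pose d := e / (2 * c).
have d0 : 0 < d by rewrite divr_gt0// mulr_gt0.
(* The tolerance contains [d^(k - 1)] to cancel the factor [d^(1 - k)], so that each part costs
   [e N / 2]. *)
have [r [r0 small]] := integral_normr_continuous integrable_quantile_powR
  (divr_gt0 (mulr_gt0 e0 (powR_gt0 (k - 1) d0)) (ltr0n _ 2)).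
near=> n => A mA An.
have n0 : 0 < n%:R :> R by rewrite ltr0n; near: n; exact: nbhs_infty_gt.
pose N := n%:R `^ k^-1 : R.
have N0 : 0 < N by exact: powR_gt0.
have kk : k != 0 by rewrite gt_eqF// (lt_le_trans _ k1).
have Nk : N `^ k = n%:R by rewrite -powRrM mulVf// powRr1// ltW.
have nr : c / n%:R < r.
  rewrite ltr_pdivrMr// mulrC -ltr_pdivrMr//; near: n; exact: nbhs_infty_gtr.
have Ar : (mu A < r%:E)%E by rewrite (le_lt_trans An)// lte_fin.
have Aoo : (mu A < +oo)%E by rewrite (lt_trans Ar) ?ltry.
have fA : n%:R * fine (mu A) <= c.
  by rewrite mulrC -ler_pdivlMr// -lee_fin fineK// ge0_fin_numE.
have := small A mA Ar.
under eq_Rintegral do rewrite ger0_norm ?powR_ge0//.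
set K := \int[_]_(_ in _) _ => Ksmall.
have iA x : mu.-integrable A (EFin \o cst x).
  apply/integrableP; split; first by apply/measurable_EFinP; exact: measurable_cst.
  by rewrite /= integral_cst// lte_mul_pinfty// lee_fin.
have iK : mu.-integrable A (EFin \o (fun u => `|q u| `^ k)).
  by apply: integrableS integrable_quantile_powR.
have iK' y : mu.-integrable A (EFin \o (fun u => `|q u| `^ k * y)).
  rewrite (_ : _ \o _ = fun u => ((`|q u| `^ k)%:E * y%:E)%E)//.
  exact: integrableZr.
have iq : mu.-integrable A (EFin \o (fun u => `|q u|)).
  by apply: integrable_norm; exact: integrable_q.
pose w := (d * N) `^ (1 - k).
have dN : 0 < d * N by exact: mulr_gt0.
(* Integrate |q| <= d N + |q|^k (d N)^(1 - k) over A, where N = n^(1/k). *)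
have bound : \int[mu]_(u in A) `|q u| <= d * N * fine (mu A) + K * w.
  rewrite -Rintegral_cst// /K -RintegralZr// -RintegralD//; last exact: iA.
  apply: le_Rintegral => //.
    rewrite (_ : _ \o _ = fun u => ((d * N)%:E + (`|q u| `^ k * w)%:E)%E)//.
    by apply: integrableD => //; [exact: iA|exact: iK'].
  by move=> u _; exact: le_add_powR.
have w0 : 0 <= w by exact: powR_ge0.
have nw : n%:R * w * d `^ (k - 1) = N.
  have E1 : d `^ (1 - k) * d `^ (k - 1) = 1.
    rewrite -powRD; last by apply/implyP => _; rewrite gt_eqF.
    by rewrite (_ : 1 - k + (k - 1) = 0) ?powRr0//; ring.
  have E2 : n%:R * N `^ (1 - k) = N.
    rewrite -{1}Nk -powRD; last by apply/implyP => _; rewrite gt_eqF.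
    by rewrite (_ : k + (1 - k) = 1) ?powRr1 ?ltW//; ring.
  rewrite /w powRM ?ltW//.
  rewrite (_ : _ * _ * _ =
    (n%:R * N `^ (1 - k)) * (d `^ (1 - k) * d `^ (k - 1))); last by ring.
  by rewrite E1 E2 mulr1.
have step : n%:R * \int[mu]_(u in A) `|q u| <=
    d * N * c + n%:R * w * (e * d `^ (k - 1) / 2).
  apply: (le_trans (ler_wpM2l (ltW n0) bound)).
  rewrite mulrDr lerD//.
    by rewrite mulrCA ler_wpM2l// ltW.
  have := ler_wpM2l (mulr_ge0 (ltW n0) w0) (ltW Ksmall).
  by rewrite -[_ * w * K]mulrA [w * K]mulrC.
rewrite (le_trans step)//.
rewrite (_ : n%:R * w * _ = e / 2 * N); last by rewrite -nw; ring.
rewrite -/N /d le_eqVlt; apply/orP; left; apply/eqP; field.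
by rewrite gt_eqF.
Unshelve. all: end_near. Qed.

End quantile_primitive.

(** * Value-at-Risk and Markov's inequality *)

Lemma measurable_sublevel d (T : measurableType d) (R : realType) (f : T -> R) y :
  measurable_fun setT f -> measurable [set w | f w <= y].
Proof.
move=> mf; rewrite -[X in measurable X]setTI.
have := measurable_fun_ler mf (measurable_cst y) => /(_ measurableT [set true]).
by apply.
Qed.

Lemma measurable_superlevel d (T : measurableType d) (R : realType) (f : T -> R) y :
  measurable_fun setT f -> measurable [set w | y <= f w].
Proof.
move=> mf; rewrite -[X in measurable X]setTI.
have := measurable_fun_ler (measurable_cst y) mf => /(_ measurableT [set true]).
by apply.
Qed.

Section value_at_risk.
Context {R : realType} d (T : measurableType d) (P : probability T R).

Lemma VaR_ge p (S : T -> R) (x : R) :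
  (forall y, y < x -> (P [set w | (S w <= y)%R] < p%:E)%E) -> (x%:E <= VaR P p S)%E.
Proof.
move=> h; apply: le_ereal_inf_tmp => _ [y /= py <-].
by rewrite lee_fin leNgt; apply/negP => /h; rewrite ltNge py.
Qed.

Lemma VaR_le p (S : T -> R) (x : R) :
  (p%:E <= P [set w | (S w <= x)%R])%E -> (VaR P p S <= x%:E)%E.
Proof. by move=> px; apply: ereal_inf_lbound; exists x. Qed.

(** The sum is dominated by the sum of the positive parts, whose expectation is additive under any
    dependence. *)
Lemma markov_sum n (Y : 'I_n -> T -> R) (J t : R) :
  (forall i, measurable_fun setT (Y i)) ->
  (forall i, \int[P]_w (Num.max (Y i w) 0)%:E = J%:E)%E -> 0 <= t ->
  (t%:E * P [set w | (t <= \sum_(i < n) Y i w)%R] <= (n%:R * J)%:E)%E.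
Proof.
move=> mY YJ t0.
have mpos i : measurable_fun setT (fun w => (Num.max (Y i w) 0)%:E).
  by apply/measurable_EFinP; exact: measurable_maxr.
have mA : measurable [set w | t <= \sum_(i < n) Y i w].
  by apply: measurable_superlevel; exact: measurable_sum.
have -> : (n%:R * J)%:E = (\int[P]_w \sum_(i < n) (Num.max (Y i w) 0)%:E)%E.
  rewrite ge0_integral_sum//; last first.
    by move=> i w _; rewrite lee_fin le_max lexx orbT.
  under eq_bigr do rewrite YJ.
  by rewrite sumEFin sumr_const card_ord mulr_natl.
rewrite -integral_cst// integral_mkcond.
apply: ge0_le_integral => //.
- by move=> w _; apply: erestrict_ge0 => ? _; rewrite lee_fin.
- exact/(measurable_restrictT _ mA)/measurable_cst.
- exact: emeasurable_sum.
- move=> w _; rewrite sumEFin patchE; case: ifPn => [|_]; last first.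
    by rewrite lee_fin sumr_ge0// => i _; rewrite le_max lexx orbT.
  rewrite inE/= lee_fin => /le_trans; apply; apply: ler_sum => i _.
  by rewrite le_max lexx.
Qed.

End value_at_risk.

(** * The coupling by rotations, and the order of the error *)

Section sums.
Context {R : realType} d (T : measurableType d) (P : probability T R)
  (F : probability (measurableTypeR R) R) (k : R).
Hypotheses (k1 : 1 <= k) (Fk : finite_moment F k).

Local Notation mu := (@lebesgue_measure R).
Local Notation q := (quantile_fun F).
Local Notation Phi := (quantile_primitive F).

(** Outside ]a, b] every rotation is the identity, so all summands coincide there; this controls the
    sum at outcomes beyond the interval. *)
Lemma rotation_coupling (U : T -> measurableTypeR R) n (a b : R) :
  uniformly_distributed P U -> (forall w, 0 < U w < 1) ->
  (0 < n)%N -> 0 < a -> a < b -> b < 1 ->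
  exists2 S : T -> R, dependent_sums P F n S &
    forall w,
      (a < U w <= b ->
         `|S w - n%:R * ((b - a)^-1 * (Phi b - Phi a))| <= q b - q a) /\
      (~~ (a < U w <= b) -> S w = n%:R * q (U w)).
Proof.
move=> uU U01 n0 a0 ab b1.
have nR : 0 < n%:R :> R by rewrite ltr0n.
pose h := (b - a) / n%:R.
have nh : n%:R * h = b - a by rewrite /h mulrC divfK// gt_eqF.
have h0 : 0 < h by rewrite divr_gt0// subr_gt0.
have c0 (i : 'I_n) : 0 <= i%:R * h <= b - a.
  by rewrite mulr_ge0 ?(ltW h0)//= -nh ler_pM2r// ler_nat ltnW.
have uV i := uniformly_distributed_rotation uU a0 b1 (c0 i).
have mX (i : 'I_n) : measurable_fun setT (q \o (rotation a b (i%:R * h) \o U)).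
  by apply: measurableT_comp; [exact: measurable_quantile_fun|case: (uV i)].
exists (fun w => \sum_(i < n) q (rotation a b (i%:R * h) (U w))).
  exists (fun i => mfun_of (mX i)); split => // i A mA.
  exact: (quantile_transform F (uV i)).
move=> w; split=> Uw; last first.
  under eq_bigr do rewrite rotation_id//.
  by rewrite sumr_const card_ord mulr_natl.
have [v vah ->] := rotation_sum q n0 nh Uw.
have := @grid_sum_bound _ q Phi a b _ _ _ n h v n0 nh vah.
move=> /(_ _ _ _)/wrap[].
- move=> x y ax xy yb; apply: quantile_fun_homo => //; first exact: lt_le_trans ax.
  exact: le_lt_trans b1.
- move=> x y ax xy yb; apply: (quantile_primitive_ge k1 Fk) => //; first exact: lt_le_trans ax.
  exact: le_lt_trans b1.
- move=> x y ax xy yb; apply: (quantile_primitive_le k1 Fk) => //.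
    by rewrite (le_trans _ ax)// ltW.
  exact: le_lt_trans b1.
set Sv := \sum_(_ <= _ < _) _ => B.
(* [B] bounds [h] times the sum; the factor is absorbed through [n h = b - a]. *)
rewrite -(ler_pM2l h0) -{1}(gtr0_norm h0) -normrM mulrBr.
rewrite (_ : h * (n%:R * _) = Phi b - Phi a)// /h; field.
by rewrite !gt_eqF// subr_gt0.
Qed.

Lemma littleo_of_tail_bound (r : nat -> R) (A B : nat -> set (measurableTypeR R))
    (c C K : R) : 0 < c -> 0 < C ->
  (forall n, measurable (A n)) -> (forall n, measurable (B n)) ->
  (forall n, (0 < n)%N -> (mu (A n) <= (c / n%:R)%:E)%E) ->
  (forall n, (0 < n)%N -> (mu (B n) <= (c / n%:R)%:E)%E) ->
  (forall n, (0 < n)%N -> 0 <= r n <=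
     C * (n%:R * \int[mu]_(u in A n) `|q u| + n%:R * \int[mu]_(u in B n) `|q u|) + K) ->
  r =o_\oo (fun n : nat => n%:R `^ k^-1 : R).
Proof.
move=> c0 C0 mA mB Ac Bc rE; apply/eqoP => _/posnumP[e].
have k0 : 0 < k by rewrite (lt_le_trans _ k1).
(* Two tails of size [e' N], multiplied by [C], use half of [e]. *)
pose e' := e%:num / (4 * C).
have e'0 : 0 < e' by rewrite divr_gt0// mulr_gt0.
(* The constant [K] fits into the other half once [n^(1/k)] exceeds [M]. *)
pose M := 2 * `|K| / e%:num.
near=> n.
have n0 : (0 < n)%N by near: n; exact: nbhs_infty_gt.
have tail : forall A, measurable A -> (mu A <= (c / n%:R)%:E)%E ->
    n%:R * \int[mu]_(u in A) `|q u| <= e' * n%:R `^ k^-1.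
  by near: n; exact: (tail_integral_small k1 Fk).
have tA := tail _ (mA n) (Ac n n0); have tB := tail _ (mB n) (Bc n n0).
have MN : M <= n%:R `^ k^-1.
  have M0 : 0 <= M by rewrite divr_ge0// mulr_ge0.
  have -> : M = (M `^ k) `^ k^-1 by rewrite -powRrM mulfV ?powRr1// gt_eqF.
  apply: ge0_ler_powR; rewrite ?nnegrE ?invr_ge0 ?powR_ge0 ?(ltW k0)//.
  by near: n; exact: nbhs_infty_ger.
have /andP[r0 rn] := rE n n0.
rewrite (ger0_norm r0) ger0_norm ?powR_ge0//.
apply: (le_trans rn).
have KN : K <= e%:num / 2 * n%:R `^ k^-1.
  rewrite (le_trans (ler_norm _))//.
  have : `|K| = e%:num / 2 * M by rewrite /M; field.
  by move=> ->; rewrite ler_wpM2l.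
have CN : C * (n%:R * \int[mu]_(u in A n) `|q u| + n%:R * \int[mu]_(u in B n) `|q u|)
    <= e%:num / 2 * n%:R `^ k^-1.
  have -> : e%:num / 2 * n%:R `^ k^-1 = C * (e' * n%:R `^ k^-1 + e' * n%:R `^ k^-1).
    by rewrite /e'; field; rewrite gt_eqF.
  by rewrite ler_wpM2l ?lerD// ltW.
by rewrite (le_trans (lerD CN KN))// -mulrDl -splitr.
Unshelve. all: by end_near. Qed.

End sums.

Lemma measurable_dependent_sums d (T : measurableType d) (R : realType)
    (P : probability T R) F n S :
  dependent_sums P F n S -> measurable_fun setT S.
Proof.
move=> [X [_ ->]]; apply: measurable_sum => i.
exact: (measurable_funP (X i)).
Qed.

(** * Bounds valid for all dependent sums, and sums that nearly attain them *)

Section dependent_sums_bounds.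
Context {R : realType} d (T : measurableType d) (P : probability T R)
  (F : probability (measurableTypeR R) R) (k p : R).
Hypotheses (k1 : 1 <= k) (Fk : finite_moment F k) (p0 : 0 < p) (p1 : p < 1).

Local Notation mu := (@lebesgue_measure R).
Local Notation q := (quantile_fun F).
Local Notation Phi := (quantile_primitive F).

Let p01 : 0 < p < 1. Proof. by rewrite p0. Qed.

Lemma VaR_dependent_sums_le n S : dependent_sums P F n S ->
  (VaR P p S <= (n%:R * ((1 - p)^-1 * (Phi 1 - Phi p)))%:E)%E.
Proof.
move=> [X [XF ->]]; set J := Phi 1 - Phi p - (1 - p) * q p.
have mX i : measurable_fun setT (X i : T -> measurableTypeR R) by exact: measurable_funP.
have mD (z : R) : measurable_fun setT (fun x : measurableTypeR R => x - z : measurableTypeR R).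
  apply: (@measurable_funB _ (measurableTypeR R)); first exact: measurable_id.
  exact: measurable_cst.
have mmax : measurable_fun [set: measurableTypeR R] (fun x => (Num.max (x - q p) 0)%:E).
  by apply/measurable_EFinP; apply: measurable_maxr; [exact: mD|exact: measurable_cst].
have EJ i : (\int[P]_w (Num.max ((X i w : R) - q p) 0)%:E = J%:E)%E.
  rewrite -(integral_pos_part k1 Fk p01).
  apply: (ge0_integral_law (XF i) mmax) => x.
  by rewrite lee_fin le_max lexx orbT.
have J0 : 0 <= J.
  rewrite -lee_fin -(integral_pos_part k1 Fk p01); apply: integral_ge0 => x _.
  by rewrite lee_fin le_max lexx orbT.
set m := (X in X%:E).
have mE : m = n%:R * q p + n%:R * J / (1 - p).
  by rewrite /m /J; field; rewrite gt_eqF// subr_gt0.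
(* The slack [e] keeps the level in Markov's inequality positive even when [J] is 0. *)
apply/lee_addgt0Pr => e e0; rewrite -EFinD; apply: VaR_le.
pose Sw w : R := \sum_(i < n) (X i w : R).
change (p%:E <= P [set w | (Sw w <= m + e)%R])%E.
rewrite leNgt; apply/negP => small.
have mS : measurable_fun setT Sw by exact: measurable_sum.
have mA := measurable_sublevel (m + e) mS.
have tail : ((1 - p)%:E < P (~` [set w | (Sw w <= m + e)%R]))%E.
  rewrite probability_setC//.
  rewrite -[P _]fineK ?fin_num_measure// in small *.
  by rewrite -EFinB lte_fin; rewrite lte_fin in small; lra.
have nJ0 : 0 <= n%:R * J / (1 - p).
  by rewrite divr_ge0 ?mulr_ge0// subr_ge0 ltW.
have t0 : 0 < m + e - n%:R * q p by rewrite mE; lra.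
have := markov_sum (fun i => measurableT_comp (mD (q p)) (mX i)) EJ (ltW t0).
apply/negP; rewrite -ltNge.
apply: (@lt_le_trans _ _ ((m + e - n%:R * q p) * (1 - p))%:E).
  rewrite lte_fin mE -ltr_pdivrMr ?subr_gt0//; lra.
rewrite EFinM; apply: lee_wpmul2l; first by rewrite lee_fin ltW.
have Sz w : \sum_(i < n) (X i w - q p) = Sw w - n%:R * q p.
  by rewrite sumrB sumr_const card_ord mulr_natl.
apply: (le_trans (ltW tail)); apply: le_measure; rewrite ?inE.
- exact: measurableC.
- by under eq_set do rewrite Sz lerD2r; exact: measurable_superlevel.
- by move=> w /= /negP; rewrite -ltNge Sz lerD2r => /ltW.
Qed.

(** If the sum were at most some [y] below the bound with probability at least [p], the sum of the
    [q p - X i] would reach [n q p - y] too often for Markov's inequality. *)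
Lemma VaR_dependent_sums_ge n S : dependent_sums P F n S ->
  ((n%:R * (p^-1 * Phi p))%:E <= VaR P p S)%E.
Proof.
move=> [X [XF ->]]; set J := p * q p - Phi p.
have mX i : measurable_fun setT (X i : T -> measurableTypeR R) by exact: measurable_funP.
have mD (z : R) : measurable_fun setT (fun x : measurableTypeR R => z - x : measurableTypeR R).
  apply: (@measurable_funB _ (measurableTypeR R)); first exact: measurable_cst.
  exact: measurable_id.
have mmax : measurable_fun [set: measurableTypeR R] (fun x => (Num.max (q p - x) 0)%:E).
  by apply/measurable_EFinP; apply: measurable_maxr; [exact: mD|exact: measurable_cst].
have EJ i : (\int[P]_w (Num.max (q p - (X i w : R)) 0)%:E = J%:E)%E.
  rewrite -(integral_neg_part k1 Fk p01).
  apply: (ge0_integral_law (XF i) mmax) => x.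
  by rewrite lee_fin le_max lexx orbT.
have J0 : 0 <= J.
  rewrite -lee_fin -(integral_neg_part k1 Fk p01); apply: integral_ge0 => x _.
  by rewrite lee_fin le_max lexx orbT.
set m := (X in X%:E).
have mE : m = n%:R * q p - n%:R * J / p by rewrite /m /J; field; rewrite gt_eqF.
pose Sw w : R := \sum_(i < n) (X i w : R).
have mS : measurable_fun setT Sw by exact: measurable_sum.
apply: VaR_ge => y ym; change (P [set w | (Sw w <= y)%R] < p%:E)%E.
rewrite ltNge; apply/negP => big.
have nJ0 : 0 <= n%:R * J / p by rewrite divr_ge0 ?mulr_ge0// ltW.
have t0 : 0 < n%:R * q p - y by lra.
have := markov_sum (fun i => measurableT_comp (mD (q p)) (mX i)) EJ (ltW t0).
apply/negP; rewrite -ltNge.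
apply: (@lt_le_trans _ _ ((n%:R * q p - y) * p)%:E).
  rewrite lte_fin -ltr_pdivrMr//; lra.
rewrite EFinM; apply: lee_wpmul2l; first by rewrite lee_fin ltW.
have Sz w : \sum_(i < n) (q p - X i w) = n%:R * q p - Sw w.
  by rewrite sumrB sumr_const card_ord mulr_natl.
apply: (le_trans big); rewrite le_eqVlt; apply/orP; left; apply/eqP; congr (P _).
by apply/seteqP; split=> w /=; rewrite Sz lerD2l lerN2.
Qed.

Section attained.
Variable U : T -> measurableTypeR R.
Hypotheses (uU : uniformly_distributed P U) (U01 : forall w, 0 < U w < 1).

Let U_le (a : R) : 0 < a < 1 -> P [set w | U w <= a] = a%:E.
Proof. by case: uU => _ _ CDF /CDF <-. Qed.

(* The rotated interval ]p - dl, 1 - dl] is as long as ]p, 1], and starts below p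
   so that the event U <= p - dl has probability less than p. *)
Lemma exists_sum_VaR_ge n (dl : R) : (0 < n)%N -> 0 < dl -> dl < p -> dl < 1 - p ->
  exists2 S, dependent_sums P F n S &
  ((n%:R * ((1 - p)^-1 * (Phi (1 - dl) - Phi (p - dl)))
    - (q (1 - dl) - q (p - dl)))%:E <= VaR P p S)%E.
Proof.
move=> n0 dl0 dlp dl1.
have [|||S FS SU] :=
  @rotation_coupling _ _ _ P F k k1 Fk U n (p - dl) (1 - dl) uU U01 n0; try lra.
exists S => //; apply: VaR_ge => y.
rewrite (_ : 1 - dl - (p - dl) = 1 - p) in SU; last by ring.
set x := _ - _ => yx.
apply: (@le_lt_trans _ _ (p - dl)%:E); last by rewrite lte_fin; lra.
rewrite -U_le; last lra.
apply: le_measure; rewrite ?inE.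
- exact: measurable_sublevel (measurable_dependent_sums FS).
- by apply: measurable_sublevel; case: uU.
have ab : p - dl <= 1 - dl by lra.
have qab : q (p - dl) <= q (1 - dl) by apply: quantile_fun_homo; lra.
(* Above the interval the sum is [n q (U w)], which still passes the bound because the mean of [q]
   over the interval is at most [q (1 - dl)]. *)
have Pb : (1 - p)^-1 * (Phi (1 - dl) - Phi (p - dl)) <= q (1 - dl).
  rewrite mulrC ler_pdivrMr ?subr_gt0// mulrC.
  have -> : 1 - p = 1 - dl - (p - dl) by ring.
  by apply: (quantile_primitive_le k1 Fk); lra.
move=> w /= Sy; rewrite leNgt; apply/negP => aU.
have [SU1 SU2] := SU w; have [Ub|bU] := leP (U w) (1 - dl).
  move: SU1; rewrite aU Ub => /(_ isT); rewrite ler_norml => /andP[+ _].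
  by rewrite /x in yx; lra.
move: SU2; rewrite aU/= -ltNge => /(_ bU) SE.
have : q (1 - dl) <= q (U w).
  by apply: quantile_fun_homo; [lra|exact: ltW|case/andP: (U01 w)].
move=> /(le_trans Pb)/(ler_wpM2l (ler0n R n)); rewrite -SE /x in yx *; lra.
Qed.

(** The rotated interval ]dl, p + dl] is as long as ]0, p], but its ends lie in ]0, 1[, where
    quantiles are finite. The event [U <= p + dl] has probability above [p], and on it the sum stays
    below the bound. *)
Lemma exists_sum_VaR_le n (dl : R) : (0 < n)%N -> 0 < dl -> dl < 1 - p ->
  exists2 S, dependent_sums P F n S &
  (VaR P p S <= (n%:R * (p^-1 * (Phi (p + dl) - Phi dl))
    + (q (p + dl) - q dl))%:E)%E.
Proof.
move=> n0 dl0 dl1.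
have [||S FS SU] := @rotation_coupling _ _ _ P F k k1 Fk U n dl (p + dl) uU U01 n0 dl0.
- by rewrite ltrDr.
- by rewrite addrC -ltrBrDr.
exists S => //; apply: VaR_le.
rewrite (_ : p + dl - dl = p) in SU; last by ring.
set x := _ + _.
apply: (@le_trans _ _ (p + dl)%:E); first by rewrite lee_fin; lra.
rewrite -U_le; last by rewrite addr_gt0//= addrC -ltrBrDr.
apply: le_measure; rewrite ?inE.
- by apply: measurable_sublevel; case: uU.
- exact: measurable_sublevel (measurable_dependent_sums FS).
have pdl1 : p + dl < 1 by rewrite addrC -ltrBrDr.
have dlp : dl <= p + dl by rewrite lerDr ltW.
have qab : q dl <= q (p + dl) by apply: quantile_fun_homo.
(* This settles the outcomes below the interval, where the sum is [n q (U w)]. *)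
have Pa : q dl <= p^-1 * (Phi (p + dl) - Phi dl).
  rewrite mulrC ler_pdivlMr// mulrC.
  rewrite [X in X * _](_ : p = p + dl - dl); last by ring.
  exact: (quantile_primitive_ge k1 Fk).
move=> w /= Ub.
have [SU1 SU2] := SU w; have [Ua|aU] := leP (U w) dl.
  move: SU2; rewrite ltNge Ua/= => /(_ isT) ->.
  have : q (U w) <= q dl.
    by apply: quantile_fun_homo; [case/andP: (U01 w)|exact: Ua|exact: le_lt_trans pdl1].
  move=> /le_trans/(_ Pa)/(ler_wpM2l (ler0n R n)); rewrite /x; lra.
move: SU1; rewrite aU Ub => /(_ isT); rewrite ler_norml => /andP[_].
by rewrite /x; lra.
Qed.

End attained.
End dependent_sums_bounds.

(** * The remainder terms and the asymptotics *)

(** Error budget for a shift [c / N]. [D1] and [e1] arise at an end of the unit interval and are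
    paid by tail integrals; [D2] and [e2] arise near [p], where the quantile is bounded by [Q], and
    cost [Q] each. The factor [2 / c] comes from replacing the value [e1] by a mean over half of the
    shift. *)
Lemma tail_error_le (R : realType) (N c w Q D1 D2 e1 e2 t1 t2 : R) :
  0 < N -> 0 < c -> 0 < w -> w * c <= 1 -> 0 <= Q -> 0 <= t1 -> 0 <= t2 ->
  D1 <= t1 -> - (c / N * Q) <= D2 -> c / N / 2 * e1 <= t2 -> - Q <= e2 ->
  N * (w * (D1 - D2)) + (e1 - e2) <= (w + 2 / c) * (N * t1 + N * t2) + 2 * Q.
Proof.
move=> N0 c0 w0 wc Q0 t10 t20 D1t D2t e1t e2Q.
have Nw : 0 <= N * w by rewrite mulr_ge0 ?ltW.
have H1 : N * (w * D1) <= w * (N * t1).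
  by rewrite mulrA [w * _]mulrCA [N * (w * t1)]mulrA ler_wpM2l.
have H2 : - (N * (w * D2)) <= Q.
  have := ler_wpM2l Nw D2t; rewrite mulrN.
  rewrite (_ : N * w * (c / N * Q) = w * c * Q); last by field; rewrite gt_eqF.
  by have := ler_wpM2r Q0 wc; lra.
have H3 : e1 <= 2 / c * (N * t2).
  rewrite (_ : 2 / c * (N * t2) = t2 / (c / N / 2)); last first.
    by field; rewrite !gt_eqF.
  by rewrite ler_pdivlMr ?divr_gt0// mulrC.
have H4 : 0 <= w * (N * t2) by rewrite !mulr_ge0 ?(ltW w0) ?(ltW N0).
have H5 : 0 <= 2 / c * (N * t1) by rewrite !mulr_ge0 ?invr_ge0 ?(ltW c0) ?(ltW N0).
lra.
Qed.

Lemma exists_remainder (R : realType) (s : nat -> \bar R) (m b : nat -> R) :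
  (forall n, (0 < n)%N -> exists2 e : R,
     ((m n - e)%:E <= s n)%E /\ (s n <= (m n)%:E)%E & e <= b n) ->
  exists r : nat -> R, (forall n, (0 < n)%N -> 0 <= r n <= b n) /\
    (forall n, (0 < n)%N -> s n = (m n - r n)%:E).
Proof.
move=> h; exists (fun n => m n - fine (s n)).
have sK n : (0 < n)%N -> s n = (fine (s n))%:E.
  move=> /h[e [es sm] _]; rewrite fineK// fin_numElt.
  by rewrite (lt_le_trans _ es) ?ltNyr//= (le_lt_trans sm) ?ltry.
split=> n n0; last by rewrite subKr; exact: sK.
by have [e] := h n n0; rewrite (sK n n0) !lee_fin /= => -[]; lra.
Qed.

Section asymptotics.
Context {R : realType} d (T : measurableType d) (P : probability T R)
  (F : probability (measurableTypeR R) R) (k p : R).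
Hypotheses (Pgen : generates_independent_vectors P) (k1 : 1 <= k)
  (Fk : finite_moment F k) (p0 : 0 < p) (p1 : p < 1).

Local Notation q := (quantile_fun F).
Local Notation Phi := (quantile_primitive F).

(** The halving keeps [p - c / n] above [p / 2] and [p + c / n] below [(1 + p) / 2] for all positive
    [n], so quantiles near [p] have a bound independent of [n]. *)
Let c : R := Num.min p (1 - p) / 2.

Let c0 : 0 < c. Proof. by rewrite divr_gt0// lt_min p0 subr_gt0. Qed.

Let c2p : 2 * c <= p. Proof. by rewrite /c mulrC divfK// ge_min lexx. Qed.

Let c2q : 2 * c <= 1 - p.
Proof. by rewrite /c mulrC divfK// ge_min lexx orbT. Qed.

Let dl_gt0 n : (0 < n)%N -> 0 < c / n%:R.
Proof. by move=> n0; rewrite divr_gt0// ltr0n. Qed.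

Let dl_ge0 n : 0 <= c / n%:R.
Proof. by rewrite divr_ge0 ?ler0n ?ltW. Qed.

Let dl_le n : (0 < n)%N -> c / n%:R <= c.
Proof. by move=> n0; rewrite ler_pdivrMr ?ltr0n// ler_peMr ?(ltW c0)// ler1n. Qed.

Let tail_ge0 (A : set (measurableTypeR R)) :
  0 <= \int[lebesgue_measure]_(u in A) `|q u|.
Proof. exact: Rintegral_ge0. Qed.

Lemma sup_VaR_dependent_sums : exists r : nat -> R,
  r =o_\oo (fun n : nat => n%:R `^ k^-1 : R) /\
  forall n : nat, (0 < n)%N ->
    (ereal_sup [set VaR P p S | S in dependent_sums P F n] =
     n%:R%:E * quantile_mean F p 1 - (r n)%:E)%E.
Proof.
have [U [uU U01]] := exists_uniform Pgen.
have sup_bounds n : (0 < n)%N -> exists2 e : R,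
  (((n%:R * ((1 - p)^-1 * (Phi 1 - Phi p)) - e)%:E <=
    ereal_sup [set VaR P p S | S in dependent_sums P F n])%E /\
   (ereal_sup [set VaR P p S | S in dependent_sums P F n] <=
    (n%:R * ((1 - p)^-1 * (Phi 1 - Phi p)))%:E)%E) &
  e <= ((1 - p)^-1 + 2 / c) *
    (n%:R * \int[lebesgue_measure]_(u in `](1 - c / n%:R)%R, 1%R]) `|q u| +
     n%:R * \int[lebesgue_measure]_(u in `](1 - c / n%:R)%R, (1 - c / n%:R / 2)%R]) `|q u|)
    + 2 * `|q (p / 2)|.
  move=> n0; set dl := c / n%:R.
  have dl0 := dl_gt0 n0; have dlc := dl_le n0; rewrite -/dl in dl0 dlc.
  have cp := c2p; have cq := c2q.
  have [||S FS VS] := exists_sum_VaR_ge k1 Fk p1 uU U01 n0 dl0; try lra.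
  (* The gap between the upper bound and the value attained by the coupling, sorted into
     contributions near 1 and near [p]. *)
  exists (n%:R * ((1 - p)^-1 * ((Phi 1 - Phi (1 - dl)) - (Phi p - Phi (p - dl))))
    + (q (1 - dl) - q (p - dl))).
    split; last first.
      apply: ge_ereal_sup => _ [S' FS' <-].
      exact: (VaR_dependent_sums_le k1 Fk p0 p1).
    apply: le_trans (ereal_sup_ubound _); last by exists S; [exact: FS|].
    apply: le_trans VS; rewrite lee_fin le_eqVlt; apply/orP; left; apply/eqP.
    ring.
  apply: tail_error_le => //; rewrite ?ltr0n ?invr_gt0 ?subr_gt0 ?mulr_ge0//.
  + by rewrite mulrC ler_pdivrMr ?subr_gt0//; lra.
  + by rewrite (le_trans (ler_norm _))// (quantile_primitive_norm k1 Fk)//; lra.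
  + have := @quantile_primitive_ge _ F k k1 Fk (p - dl) p.
    move=> /(_ _ _ p1)/wrap[]; [lra|lra|apply: le_trans].
    rewrite subKr -mulrN ler_wpM2l ?(ltW dl0)//.
    apply: le_trans (_ : q (p / 2) <= _); first by rewrite lerNl ler_normr lexx orbT.
    by apply: quantile_fun_homo; lra.
  (* Since [q (1 - dl)] may be unbounded in [n], it is compared with an integral over an interval of
     length [dl / 2] that stops short of 1. *)
  + have := @quantile_primitive_ge _ F k k1 Fk (1 - dl) (1 - dl / 2).
    rewrite (_ : 1 - dl / 2 - (1 - dl) = dl / 2); last by field.
    move=> /(_ _ _ _)/wrap[]; [lra|lra|lra|move/le_trans; apply].
    rewrite (le_trans (ler_norm _))// (quantile_primitive_norm k1 Fk)//; lra.
  + apply: le_trans (_ : q (p / 2) <= _); first by rewrite lerNl ler_normr lexx orbT.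
    by apply: quantile_fun_homo; lra.
have [r [rE sE]] := exists_remainder sup_bounds.
exists r; split; last first.
  by move=> n n0; rewrite sE// (quantile_meanE k1 Fk) ?(ltW p0)// -EFinM -EFinB.
apply: (littleo_of_tail_bound k1 Fk c0 _ _ _ _ _ rE).
+ by apply: addr_gt0; [rewrite invr_gt0 subr_gt0|exact: divr_gt0].
+ by [].
+ by [].
+ move=> n n0; rewrite lebesgue_measure_oc ?lee_fin ?subKr//.
  by rewrite lerBlDr lerDl.
+ move=> n n0; have := dl_ge0 n => ?.
  rewrite lebesgue_measure_oc ?lee_fin//; lra.
Qed.

Lemma inf_VaR_dependent_sums : exists r : nat -> R,
  r =o_\oo (fun n : nat => n%:R `^ k^-1 : R) /\
  forall n : nat, (0 < n)%N ->
    (ereal_inf [set VaR P p S | S in dependent_sums P F n] =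
     n%:R%:E * quantile_mean F 0 p + (r n)%:E)%E.
Proof.
have [U [uU U01]] := exists_uniform Pgen.
(* The infimum is negated so that the same remainder and error lemmas apply, with all signs
   reversed. *)
have inf_bounds n : (0 < n)%N -> exists2 e : R,
  (((- (n%:R * (p^-1 * Phi p))) - e)%:E <=
    - ereal_inf [set VaR P p S | S in dependent_sums P F n])%E /\
   (- ereal_inf [set VaR P p S | S in dependent_sums P F n] <=
    (- (n%:R * (p^-1 * Phi p)))%:E)%E &
  e <= (p^-1 + 2 / c) *
    (n%:R * \int[lebesgue_measure]_(u in `]0%R, (c / n%:R)%R]) `|q u| +
     n%:R * \int[lebesgue_measure]_(u in `](c / n%:R / 2)%R, (c / n%:R)%R]) `|q u|)
    + 2 * `|q ((1 + p) / 2)|.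
  move=> n0; set dl := c / n%:R.
  have dl0 := dl_gt0 n0; have dlc := dl_le n0; rewrite -/dl in dl0 dlc.
  have cp := c2p; have cq := c2q.
  have dl1 : dl < 1 - p by lra.
  have [S FS VS] := exists_sum_VaR_le k1 Fk p0 uU U01 n0 dl0 dl1.
  exists (n%:R * (p^-1 * ((- Phi dl) - (- (Phi (p + dl) - Phi p))))
    + ((- q dl) - (- q (p + dl)))).
    split; last first.
      rewrite leeNl -EFinN opprK; apply: le_ereal_inf_tmp => _ [S' FS' <-].
      exact: (VaR_dependent_sums_ge k1 Fk p0 p1).
    rewrite leeNr; apply: le_trans (ereal_inf_lbound _) _; first by exists S; [exact: FS|].
    apply: (le_trans VS); rewrite -EFinN lee_fin le_eqVlt; apply/orP; left; apply/eqP.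
    ring.
  have dlp : p <= p + dl by rewrite lerDl ltW.
  have pdl : p + dl <= (1 + p) / 2.
    rewrite ler_pdivlMr// mulrDl; lra.
  have s1 : (1 + p) / 2 < 1 by rewrite ltr_pdivrMr//; lra.
  have pdl1 := le_lt_trans pdl s1.
  have qs : q (p + dl) <= `|q ((1 + p) / 2)|.
    rewrite (le_trans _ (ler_norm _))//; apply: quantile_fun_homo => //.
    exact: lt_le_trans dlp.
  apply: tail_error_le => //; rewrite ?ltr0n ?invr_gt0//.
  + by rewrite mulrC ler_pdivrMr//; lra.
  + rewrite -[- _](_ : - (Phi dl - Phi 0) = _); last by rewrite quantile_primitive0 subr0.
    rewrite (le_trans (ler_norm _))// normrN (quantile_primitive_norm k1 Fk)//.
    exact: ltW.
  + rewrite lerN2.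
    have := @quantile_primitive_le _ F k k1 Fk p (p + dl) (ltW p0) dlp pdl1.
    rewrite (_ : p + dl - p = dl) => [/le_trans|]; last by ring.
    by apply; rewrite ler_wpM2l ?(ltW dl0).
  (* By monotonicity, [- q dl] is at most the mean of [- q] over ]dl / 2, dl]. *)
  + have := @quantile_primitive_le _ F k k1 Fk (dl / 2) dl.
    rewrite (_ : dl - dl / 2 = dl / 2); last by field.
    move=> /(_ _ _ _)/wrap[]; [lra|lra|lra|].
    rewrite mulrN -lerN2 => /le_trans; apply.
    rewrite (le_trans (ler_norm _))// normrN (quantile_primitive_norm k1 Fk)//; lra.
  + by rewrite lerN2.
have [r [rE sE]] := exists_remainder inf_bounds.
exists r; split; last first.
  move=> n n0; rewrite -[LHS]oppeK sE// (quantile_meanE k1 Fk) ?(ltW p1)//.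
  by rewrite quantile_primitive0 !subr0 -EFinM -EFinD -EFinN opprB opprK addrC.
apply: (littleo_of_tail_bound k1 Fk c0 _ _ _ _ _ rE).
+ by apply: addr_gt0; [rewrite invr_gt0|exact: divr_gt0].
+ by [].
+ by [].
+ by move=> n n0; rewrite lebesgue_measure_oc ?lee_fin ?subr0.
+ move=> n n0; have := dl_ge0 n => ?.
  rewrite lebesgue_measure_oc ?lee_fin//; lra.
Qed.

End asymptotics.

Local Open Scope ereal_scope.

Theorem corollary3p6 (R : realType) (d : measure_display)
    (T : measurableType d) (P : probability T R)
    (F : probability (measurableTypeR R) R) (p k : R) :
  atomless P ->
  generates_independent_vectors P ->
  (0 < p < 1)%R ->
  (1 <= k)%R ->
  finite_moment F k ->
  (exists r : nat -> R,
     r =o_\oo (fun n : nat => n%:R `^ k^-1 : R)%R /\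
     forall n : nat, (0 < n)%N ->
       ereal_sup [set VaR P p S | S in dependent_sums P F n] =
       n%:R%:E * quantile_mean F p 1 - (r n)%:E) /\
  (exists r : nat -> R,
     r =o_\oo (fun n : nat => n%:R `^ k^-1 : R)%R /\
     forall n : nat, (0 < n)%N ->
       ereal_inf [set VaR P p S | S in dependent_sums P F n] =
       n%:R%:E * quantile_mean F 0 p + (r n)%:E).
Proof.
move=> _ Pgen /andP[p0 p1] k1 Fk.
by split; [exact: sup_VaR_dependent_sums|exact: inf_VaR_dependent_sums].
Qed.
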